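(* Let $m\ge1$ be an integer and let $\mathcal{G}$ be a guessing strategy for $X$ whose induced weights $q_1,\dots,q_{M'}$, $M'=\sum_{i=1}^M\lceil c_i\rceil$, satisfy $$q_{k+1}^{1/(m+1)}\le\frac1k\left(q_1^{1/(m+1)}+\dots+q_k^{1/(m+1)}\right),\qquad k=1,\dots,M'-1 .$$ Then, with $\overline{c}_X(m+1)$ the balancing cost at $m+1$, $$\mathbb{E}[C_{\mathcal{G}}(X)^m]\le\frac{1}{\overline{c}_X(m+1)\,(m+1)}\left[\left[\sum_{k=1}^{M'}q_k^{\frac1{m+1}}\right]^{m+1}+\sum_{l=0}^{m-1}\binom{m+1}{l}\mathbb{E}[C_{\mathcal{G}}(X)^l]\left(-\overline{c}_X(m+1)\right)^{m+1-l}\right].$$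
   Context: $X$ is a random variable on a finite set $\mathcal{X}$ with $|\mathcal{X}|=M$ and distribution $P_X$; each $x\in\mathcal{X}$ has a fixed real cost $c_x\ge1$. A guessing strategy is a bijection $\mathcal{G}:\mathcal{X}\to\{1,\dots,M\}$. For a given $\mathcal{G}$ write $p_i=P_X(\mathcal{G}^{-1}(i))$ and $c_i=c_{\mathcal{G}^{-1}(i)}$. The guessing cost is $C_{\mathcal{G}}(x)=\sum_{j=1}^{\mathcal{G}(x)}c_j$, so $\mathbb{E}[C_{\mathcal{G}}(X)^\rho]=\sum_{i=1}^M p_i\left(\sum_{j=1}^i c_j\right)^\rho$. Induced weights: $q_k=p_i$ for $\sum_{l=1}^{i-1}\lceil c_l\rceil<k\le\sum_{l=1}^{i}\lceil c_l\rceil$, $i=1,\dots,M$. Balancing cost: for $\rho>0$, $\overline{c}_X(\rho)$ is a real number satisfying $\sum_{i=1}^M\left(\sum_{j=1}^{i-1}c_j\right)^\rho p_i=\sum_{i=1}^M\left(\sum_{j=1}^{i}c_j-\overline{c}_X(\rho)\right)^\rho p_i$ (equal to the common cost if all costs are equal). *)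

(* Defs.v *)
From mathcomp Require Import all_boot all_order all_algebra.
From mathcomp Require Import all_classical all_reals all_analysis.
Set Implicit Arguments.
Unset Strict Implicit.
Unset Printing Implicit Defensive.
Import Order.TTheory GRing.Theory Num.Theory.
Local Open Scope ring_scope.

(* The random variable enters only through its distribution P_X on the finite
   alphabet T, so it is represented by its probability mass function. *)
Definition is_distribution (R : realType) (T : finType) (P : T -> R) : Prop :=
  (forall x, 0 <= P x) /\ \sum_(x : T) P x = 1.

Definition expectation (R : realType) (T : finType) (P f : T -> R) : R :=
  \sum_(x : T) P x * f x.

(* A bijection T -> {1, ..., M}, M = #|T|, bundled with its inverse. Positions
   are shifted to {0, ..., M-1}: the i-th guess has position i - 1 : 'I_#|T|. *)
Record strategy (T : finType) := Strategy {
  position :> T -> 'I_#|T|;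
  guess : 'I_#|T| -> T;
  positionK : cancel position guess;
  guessK : cancel guess position
}.

Section Guessing.
Variables (R : realType) (T : finType) (P c : T -> R) (G : strategy T).

Definition prob_at (i : 'I_#|T|) : R := P (guess G i).
Definition cost_at (i : 'I_#|T|) : R := c (guess G i).

Definition cost_through (i : 'I_#|T|) : R :=
  \sum_(j < #|T| | (j <= i)%N) cost_at j.
Definition cost_before (i : 'I_#|T|) : R :=
  \sum_(j < #|T| | (j < i)%N) cost_at j.

Definition guessing_cost (x : T) : R := cost_through (G x).

(* E[C_G(X)^l] *)
Definition guessing_moment (l : nat) : R :=
  expectation P (fun x => guessing_cost x ^+ l).

(* The ceiling is an int; costs are at least 1, so absz only casts it to nat. *)
Definition ceil_cost (i : 'I_#|T|) : nat := `|Num.ceil (cost_at i)|%N.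

(* M' *)
Definition total_ceil_cost : nat := (\sum_(i < #|T|) ceil_cost i)%N.

(* q is indexed from 1, as in q_1, ..., q_M'; its values outside that range
   are left free. *)
Definition induced_weights (q : nat -> R) : Prop :=
  forall (i : 'I_#|T|) (k : nat),
    (\sum_(l < #|T| | (l < i)%N) ceil_cost l < k)%N ->
    (k <= \sum_(l < #|T| | (l <= i)%N) ceil_cost l)%N ->
    q k = prob_at i.

(* The exponent is a natural number, so the power also makes sense where
   cost_through i - cbar is negative. The equation may have several solutions;
   the second clause selects the common cost when all costs agree. *)
Definition balancing_cost (n : nat) (cbar : R) : Prop :=
  \sum_(i < #|T|) cost_before i ^+ n * prob_at i
    = \sum_(i < #|T|) (cost_through i - cbar) ^+ n * prob_at i
  /\ (forall c0 : R, (forall x, c x = c0) -> cbar = c0).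

End Guessing.

(* Main.v *)
Require Import Defs.
From mathcomp Require Import all_boot all_order all_algebra.
From mathcomp Require Import all_classical all_reals all_analysis.
From mathcomp Require Import ring lra.
Set Implicit Arguments.
Unset Strict Implicit.
Unset Printing Implicit Defensive.
Import Order.TTheory GRing.Theory Num.Theory.
Local Open Scope ring_scope.

(* Write n = m + 1, S_i for the cost of the first i guesses and T_i for its
   rounded-up version.  Expanding (S_i - cbar)^n binomially, the balancing
   equation turns the claim into
     sum_i p_i (S_i^n - S_(i-1)^n) <= (sum_k q_k^(1/n))^n.
   Everything then rests on the convexity of x^n: its increments grow with the
   base point and with the step.  Hence S can be replaced by T, which makes the
   left side sum_k q_k (k^n - (k-1)^n); and with A_k = sum_(j <= k) q_j^(1/n),
   the hypothesis (k-1) q_k^(1/n) <= A_(k-1) gives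
   q_k (k^n - (k-1)^n) <= A_k^n - A_(k-1)^n, which telescopes. *)

(** Each difference factors as the step times a sum of products of powers of the two endpoints; the
    step and every such product are nonnegative and no larger on the left. *)
Lemma ler_incrX (R : realType) (n : nat) (a b c d : R) :
  0 <= a -> a <= b -> 0 <= c -> c <= d ->
  (a + c) ^+ n - a ^+ n <= (b + d) ^+ n - b ^+ n.
Proof.
move=> a0 ab c0 cd.
have b0 := le_trans a0 ab; have d0 := le_trans c0 cd.
rewrite !subrXX ![_ + _ - _]addrAC !subrr !add0r.
apply: ler_pM => //; first by apply: sumr_ge0 => i _; rewrite mulr_ge0 ?exprn_ge0 ?addr_ge0.
apply: ler_sum => i _.
by apply: ler_pM; rewrite ?exprn_ge0 ?addr_ge0 // lerXn2r ?nnegrE ?addr_ge0 ?lerD.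
Qed.

Lemma powR_invnK (R : realType) (n : nat) (x : R) :
  0 <= x -> (x `^ (1 / n.+1%:R)) ^+ n.+1 = x.
Proof.
by move=> x0; rewrite -powR_mulrn ?powR_ge0 // -powRrM div1r mulVf ?pnatr_eq0 // powRr1.
Qed.

(** With x = [a k.+1], both sides are increments of the n-th power with the same step x, from base k
    x on the left and from the prefix sum on the right. For k = 0 both bases vanish, hence the guard
    on the hypothesis. *)
Lemma incrX_prefix_sum (R : realType) (n k : nat) (a : nat -> R) :
  (forall j, 0 <= a j) ->
  ((0 < k)%N -> a k.+1 <= 1 / k%:R * \sum_(1 <= j < k.+1) a j) ->
  a k.+1 ^+ n * (k.+1%:R ^+ n - k%:R ^+ n)
    <= (\sum_(1 <= j < k.+2) a j) ^+ n - (\sum_(1 <= j < k.+1) a j) ^+ n.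
Proof.
move=> a0 hak.
rewrite (big_nat_recr k.+1) //= mulrBr -!exprMn -natr1 mulrDr mulr1.
apply: ler_incrX => //; first by rewrite mulr_ge0.
case: k hak => [|k] hak; first by rewrite mulr0 big_geq.
by rewrite -ler_pdivlMr ?ltr0n // mulrC -div1r; exact: hak.
Qed.

Lemma natr_absz_ceil (R : realType) (x : R) :
  0 <= x -> x <= (`|Num.ceil x|%N)%:R.
Proof.
move=> x0; rewrite natr_absz ger0_norm ?ceil_ge //.
by rewrite -(ler_int R) (le_trans x0) ?ceil_ge.
Qed.

Section Guessing.
Variables (R : realType) (T : finType) (P c : T -> R) (G : strategy T).

Lemma cost_throughE (i : 'I_#|T|) :
  cost_through c G i = cost_before c G i + cost_at c G i.
Proof.
rewrite /cost_through /cost_before (bigD1 i) //= addrC; congr (_ + _).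
by apply: eq_bigl => j; rewrite ltn_neqAle andbC.
Qed.

Lemma sum_prob_at : \sum_i prob_at P G i = \sum_x P x.
Proof.
by rewrite [RHS](reindex (guess G)) //; exists G => x _; rewrite ?positionK ?guessK.
Qed.

Lemma guessing_momentE (l : nat) :
  guessing_moment P c G l = \sum_i prob_at P G i * cost_through c G i ^+ l.
Proof.
rewrite /guessing_moment /Defs.expectation (reindex (guess G)) /=.
  by apply: eq_bigr => i _; rewrite /guessing_cost guessK.
by exists G => x _; rewrite ?positionK ?guessK.
Qed.

Lemma moment_binomial (n : nat) (x : R) :
  \sum_i (cost_through c G i - x) ^+ n * prob_at P G i
    = \sum_(0 <= l < n.+1)
        'C(n, l)%:R * guessing_moment P c G l * (- x) ^+ (n - l).
Proof.
rewrite big_mkord.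
under [RHS]eq_bigr do rewrite guessing_momentE mulr_sumr mulr_suml.
rewrite exchange_big; apply: eq_bigr => i _ /=.
rewrite addrC exprDn mulr_suml; apply: eq_bigr => l _.
by rewrite -mulr_natr; ring.
Qed.

Hypotheses (hP : is_distribution P) (hc : forall x, 1 <= c x).

Lemma prob_at_ge0 (i : 'I_#|T|) : 0 <= prob_at P G i.
Proof. exact: hP.1. Qed.

Lemma cost_at_ge0 (i : 'I_#|T|) : 0 <= cost_at c G i.
Proof. exact: le_trans (hc _). Qed.

Lemma cost_before_ge0 (i : 'I_#|T|) : 0 <= cost_before c G i.
Proof. by apply: sumr_ge0 => j _; exact: cost_at_ge0. Qed.

(** Allows division by [cbar]. If [cbar <= 0], every step from [cost_before] to
    [cost_through - cbar] is at least 1, so each power grows by at least 1^(n+1) - 0^(n+1) = 1;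
    averaging contradicts the balance. *)
Lemma balancing_cost_gt0 (n : nat) (cbar : R) :
  balancing_cost P c G n.+1 cbar -> 0 < cbar.
Proof.
move=> [hbal _]; rewrite ltNge; apply/negP => cbar_le0.
suff : 1 <= (0 : R) by rewrite ler10.
have : \sum_i ((cost_through c G i - cbar) ^+ n.+1 - cost_before c G i ^+ n.+1)
    * prob_at P G i = 0.
  by under eq_bigr do rewrite mulrBl; rewrite sumrB -hbal subrr.
move=> <-; rewrite -hP.2 -sum_prob_at; apply: ler_sum => i _.
rewrite ler_peMl ?prob_at_ge0 // cost_throughE -addrA.
have := @ler_incrX R n.+1 0 (cost_before c G i) 1 (cost_at c G i - cbar).
rewrite add0r expr1n expr0n /= subr0; apply => //; first exact: cost_before_ge0.
by have := hc (guess G i); rewrite /cost_at; lra.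
Qed.

(** A natural argument, not an ordinal, lets [r] reach [#|T|], the upper end of the telescoping
    sum. *)
Definition ceil_before (r : nat) : nat :=
  (\sum_(l < #|T| | (l < r)%N) ceil_cost c G l)%N.

Lemma ceil_beforeS (i : 'I_#|T|) :
  ceil_before i.+1 = (ceil_before i + ceil_cost c G i)%N.
Proof.
rewrite /ceil_before (bigD1 i) //= addnC; congr (_ + _)%N.
by apply: eq_bigl => j; rewrite ltnS [RHS]ltn_neqAle andbC.
Qed.

Lemma cost_at_le_ceil (i : 'I_#|T|) : cost_at c G i <= (ceil_cost c G i)%:R.
Proof. exact/natr_absz_ceil/cost_at_ge0. Qed.

Lemma incrX_cost_le_ceil (n : nat) (i : 'I_#|T|) :
  cost_through c G i ^+ n - cost_before c G i ^+ n
    <= (ceil_before i.+1)%:R ^+ n - (ceil_before i)%:R ^+ n.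
Proof.
rewrite cost_throughE ceil_beforeS natrD; apply: ler_incrX.
- exact: cost_before_ge0.
- by rewrite natr_sum; apply: ler_sum => j _; exact: cost_at_le_ceil.
- exact: cost_at_ge0.
- exact: cost_at_le_ceil.
Qed.

Lemma ceil_before_total : ceil_before #|T| = total_ceil_cost c G.
Proof. by apply: eq_bigl => i; rewrite ltn_ord. Qed.

Lemma ceil_before_le_total (r : nat) : (ceil_before r <= total_ceil_cost c G)%N.
Proof. by rewrite /ceil_before big_mkcond; apply: leq_sum => i _; case: ifP. Qed.

Variables (n : nat) (q : nat -> R).
Hypothesis hq : induced_weights P c G q.
Hypothesis hqle : forall k : nat,
  (1 <= k)%N -> (k <= (total_ceil_cost c G).-1)%N ->
  q k.+1 `^ (1 / n.+1%:R)
    <= 1 / k%:R * \sum_(1 <= j < k.+1) q j `^ (1 / n.+1%:R).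

Let A (k : nat) : R := \sum_(1 <= j < k.+1) q j `^ (1 / n.+1%:R).

(** Both sides telescope over the block of indices on which [q] equals [prob_at P G i], leaving one
    inequality per index. *)
Lemma incrX_ceil_le_weights (i : 'I_#|T|) :
  prob_at P G i
      * ((ceil_before i.+1)%:R ^+ n.+1 - (ceil_before i)%:R ^+ n.+1)
    <= A (ceil_before i.+1) ^+ n.+1 - A (ceil_before i) ^+ n.+1.
Proof.
have le_t : (ceil_before i <= ceil_before i.+1)%N by rewrite ceil_beforeS leq_addr.
rewrite -(telescope_sumr (fun k => k%:R ^+ n.+1) le_t).
rewrite -(telescope_sumr (fun k => A k ^+ n.+1) le_t) mulr_sumr.
apply: ler_sum_nat => k /andP[lek ltk].
(* Weights are indexed from 1: k in [[ceil_before i], [ceil_before i.+1]) puts k + 1 in block i. *)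
have <- : q k.+1 = prob_at P G i by apply: hq.
have qk0 : 0 <= q k.+1 by rewrite (hq (i := i)) // prob_at_ge0.
rewrite -{1}(powR_invnK n qk0).
(* [powR] is nonnegative at every base, so the free values of [q] do no harm. *)
apply: (@incrX_prefix_sum R n.+1 k (fun j => q j `^ _)) => [j|k0]; first exact: powR_ge0.
apply: hqle => //.
by have := leq_trans ltk (ceil_before_le_total i.+1); case: (total_ceil_cost c G).
Qed.

Lemma incr_moment_le_weights :
  \sum_i prob_at P G i * (cost_through c G i ^+ n.+1 - cost_before c G i ^+ n.+1)
    <= A (total_ceil_cost c G) ^+ n.+1.
Proof.
have -> : A (total_ceil_cost c G) ^+ n.+1
    = \sum_(i < #|T|) (A (ceil_before i.+1) ^+ n.+1 - A (ceil_before i) ^+ n.+1).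
  rewrite -(big_mkord xpredT (fun i => A (ceil_before i.+1) ^+ n.+1
                                       - A (ceil_before i) ^+ n.+1)).
  rewrite (telescope_sumr (fun i => A (ceil_before i) ^+ n.+1)) //.
  rewrite ceil_before_total [ceil_before 0]big_pred0 //.
  by rewrite {3}/A big_geq // expr0n subr0.
apply: ler_sum => i _; apply: le_trans (incrX_ceil_le_weights i).
by rewrite ler_wpM2l ?prob_at_ge0 ?incrX_cost_le_ceil.
Qed.

End Guessing.

Theorem theorem3p4 (R : realType) (T : finType) (P c : T -> R)
  (hP : is_distribution P) (hc : forall x, 1 <= c x)
  (m : nat) (hm : (1 <= m)%N)
  (G : strategy T) (q : nat -> R) (hq : induced_weights P c G q)
  (hqle : forall k : nat, (1 <= k)%N -> (k <= (total_ceil_cost c G).-1)%N ->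
     q k.+1 `^ (1 / m.+1%:R)
       <= 1 / k%:R * \sum_(1 <= j < k.+1) q j `^ (1 / m.+1%:R))
  (cbar : R) (hcbar : balancing_cost P c G m.+1 cbar) :
  guessing_moment P c G m
    <= 1 / (cbar * m.+1%:R) *
       ((\sum_(1 <= k < (total_ceil_cost c G).+1)
            q k `^ (1 / m.+1%:R)) ^+ m.+1
        + \sum_(0 <= l < m)
            'C(m.+1, l)%:R * guessing_moment P c G l * (- cbar) ^+ (m.+1 - l)).
Proof.
have cbar0 : 0 < cbar := balancing_cost_gt0 hP hc hcbar.
have main := incr_moment_le_weights hP hc hq hqle.
have [bal _] := hcbar.
(* The terms l = m + 1 and l = m are split off: the first cancels against the moment of order m + 1
   in [main], the second is -(m + 1) [cbar] times the moment to be bounded. *)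
rewrite moment_binomial 2?big_nat_recr //= in bal.
rewrite subnn subSnn expr0 expr1 mulr1 binn mul1r binSn in bal.
rewrite div1r -ler_pdivrMl ?invr_gt0 ?mulr_gt0 ?ltr0n // invrK.
move: main; under eq_bigr do rewrite mulrBr.
rewrite sumrB -guessing_momentE.
under [X in _ - X]eq_bigr do rewrite mulrC.
by rewrite bal; lra.
Qed.
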